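(* Let $\mathfrak{A}$ be a complex unital algebra with normalized linear functionals $\varphi,\psi:\mathfrak{A}\to\mathbb{C}$, let $X\in\mathfrak{A}$ with $\psi(X)\neq0$, and put $m_n=\psi(X^n)$, $M_n=\varphi(X^n)$. Let $T(z)=\sum_{n\ge0}t_nz^n$ and ${}^cT(z)=\sum_{n\ge0}{}^ct_nz^n$ be the $T$-transform and the ${}^cT$-transform of $X$. Then for every $n\ge1$: (i) $\displaystyle m_n=\sum_{\gamma\in NCL(n)}t_0^{\,n-|\gamma|}\prod_{B\in\gamma}t_{|B|-1}$; (ii) $\displaystyle M_n=\sum_{\gamma\in NCL(n)}t_0^{\,n-|\gamma|}\prod_{B\in ext(\gamma)}{}^ct_{|B|-1}\prod_{B\in int(\gamma)}t_{|B|-1}$.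
   Context: Normalized means $\varphi(1)=\psi(1)=1$. Let $m(z)=\sum_{n\ge1}\psi(X^n)z^n$ and $M(z)=\sum_{n\ge1}\varphi(X^n)z^n$. The $R$- and ${}^cR$-transforms of $X$ are the formal power series (without constant term) determined by $R(z[1+m(z)])=m(z)$ and ${}^cR(z[1+m(z)])(1+M(z))=M(z)(1+m(z))$. The $T$- and ${}^cT$-transforms are $T=\left(\frac1zR\right)\circ R^{\langle-1\rangle}$ and ${}^cT=\left(\frac1z{}^cR\right)\circ R^{\langle-1\rangle}$, where $F^{\langle-1\rangle}$ is the inverse under composition and $\left(\frac1zF\right)\circ G$ is $F(z)/z$ composed with $G$. A non-crossing linked partition $\gamma$ of $\{1,\dots,n\}$ is a collection of (nonempty, distinct) subsets $B_1,\dots,B_k$ of $\{1,\dots,n\}$, called blocks, such that: (1) their union is $\{1,\dots,n\}$; (2) there are no two distinct blocks $B_l,B_s$ and $i<k<p<q$ with $i,p\in B_l$ and $k,q\in B_s$; (3) for any two distinct blocks $B_l,B_s$, the intersection $B_l\cap B_s$ is empty or a single element $j$, and in the latter case $|B_l|,|B_s|\ge2$ and $j$ is the minimal element of exactly one of $B_l,B_s$. $NCL(n)$ is the set of all such $\gamma$, and $|\gamma|$ is the number of blocks of $\gamma$. A block $B$ of $\gamma$ is exterior if there is no other block $D$ of $\gamma$ containing two elements $l,s$ with $l<\min(B)\le s$; $ext(\gamma)$ is the set of exterior blocks and $int(\gamma)$ the set of the remaining blocks. For example, $\gamma=\{(1,4,6,9),(2,3),(4,5),(6,7,8),(10,11),(11,12)\}\in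 NCL(12)$ has $ext(\gamma)=\{(1,4,6,9),(10,11)\}$ and $int(\gamma)=\{(2,3),(4,5),(6,7,8),(11,12)\}$. *)

(* Defs.v *)
From HB Require Import structures.
From mathcomp Require Import all_boot all_order all_algebra.
From mathcomp Require Import reals complex.
Set Implicit Arguments.
Unset Strict Implicit.
Unset Printing Implicit Defensive.
Import GRing.Theory.
Local Open Scope ring_scope.

(* A formal power series is its coefficient sequence; equality of series is
   the pointwise equality [=1]. *)
Definition fps (C : Type) := nat -> C.

Section PowerSeries.
Variable C : fieldType.
Implicit Types F G : fps C.

Definition fps1 : fps C := fun n => (n == 0%N)%:R.
Definition fpsX : fps C := fun n => (n == 1%N)%:R.
Definition fps_add F G : fps C := fun n => F n + G n.
Definition fps_mul F G : fps C := fun n => \sum_(i < n.+1) F i * G (n - i)%N.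
Definition fps_exp F k : fps C := iter k (fps_mul F) fps1.

(* Truncating the sum over k at k = n is exact when G has no constant term
   (then G ^ k has no coefficient of degree < k); composition is only used
   for such G. *)
Definition fps_comp F G : fps C :=
  fun n => \sum_(k < n.+1) F k * fps_exp G k n.

(* F(z) / z, for F without constant term *)
Definition fps_divX F : fps C := fun n => F n.+1.

Definition is_fps_compinv F G : Prop :=
  [/\ G 0%N = 0, fps_comp F G =1 fpsX & fps_comp G F =1 fpsX].

End PowerSeries.

Section Transforms.
Variables (C : fieldType) (A : algType C).
Implicit Types (phi psi : {scalar A}) (X : A).

Definition moment_series psi X : fps C :=
  fun n => if n == 0%N then 0 else psi (X ^+ n).

Definition is_R_transform psi X (RX : fps C) : Prop :=
  let m := moment_series psi X in
  RX 0%N = 0 /\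
  fps_comp RX (fps_mul (fpsX C) (fps_add (fps1 C) m)) =1 m.

Definition is_cR_transform phi psi X (cRX : fps C) : Prop :=
  let m := moment_series psi X in
  let M := moment_series phi X in
  cRX 0%N = 0 /\
  fps_mul (fps_comp cRX (fps_mul (fpsX C) (fps_add (fps1 C) m)))
          (fps_add (fps1 C) M)
  =1 fps_mul M (fps_add (fps1 C) m).

(* The series RX, cRX and RXinv quantified below are uniquely determined by
   their properties, and they exist when psi X != 0. *)
Definition is_T_transform psi X (T : fps C) : Prop :=
  exists RX RXinv : fps C,
    [/\ is_R_transform psi X RX, is_fps_compinv RX RXinv
      & T =1 fps_comp (fps_divX RX) RXinv].

Definition is_cT_transform phi psi X (cT : fps C) : Prop :=
  exists RX cRX RXinv : fps C,
    [/\ is_R_transform psi X RX, is_cR_transform phi psi X cRX,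
        is_fps_compinv RX RXinv
      & cT =1 fps_comp (fps_divX cRX) RXinv].

End Transforms.

(* The ordered set {1, ..., n} is represented by 'I_n = {0, ..., n - 1}. *)
Section LinkedPartitions.
Variable n : nat.
Implicit Types (B D : {set 'I_n}) (g : {set {set 'I_n}}).

Definition is_min B (j : 'I_n) : bool :=
  (j \in B) && [forall i in B, (j <= i)%N].

(* i < k < p < q with i, p in B and k, q in D *)
Definition crossing B D : bool :=
  [exists i in B, exists k in D, exists p in B, exists q in D,
    [&& (i < k)%N, (k < p)%N & (p < q)%N]].

Definition linked B D : bool :=
  (B :&: D == set0) ||
  [exists j, [&& B :&: D == [set j], (2 <= #|B|)%N, (2 <= #|D|)%N
               & is_min B j (+) is_min D j]].

Definition NCL : {set {set {set 'I_n}}} :=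
  [set g : {set {set 'I_n}} |
    [&& set0 \notin g, cover g == [set: 'I_n]
      & [forall B in g, forall D in g,
           (B != D) ==> ~~ crossing B D && linked B D]]].

Definition exterior g B : bool :=
  ~~ [exists D in g, (D != B) &&
        [exists b, is_min B b &&
          [exists l in D, exists s in D, (l < b <= s)%N]]].

Definition ext g : {set {set 'I_n}} := [set B in g | exterior g B].
Definition int_blocks g : {set {set 'I_n}} := g :\: ext g.

End LinkedPartitions.

(* Main.v *)
Require Import Defs.
From HB Require Import structures.
From mathcomp Require Import all_boot all_order all_algebra.
From mathcomp Require Import reals complex.
From mathcomp Require Import zify.
Set Implicit Arguments.
Unset Strict Implicit.
Unset Printing Implicit Defensive.
Import GRing.Theory.

(** The transforms satisfy [m = z T(m) (1 + m)] and [M = z cT(m) (1 + M)].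

    In a non-crossing linked partition, send [j] to its parent: the minimum of
    the block containing [j] as a non-minimal element, or [j] itself if there is
    none. This encodes the partitions as the functions [f] with [f j <= j] and
    without [p < q] such that [f p < f q < p]. If [c_j] is the number of
    [i != j] with parent [j], an element that is not the minimum of a block has
    [c_j = 0], so the factor [t_0 ^ (n - |g|)] turns the weight of the partition
    into the product over all [j] of [ct_(c_j)] or [t_(c_j)], according to
    whether there is no [s >= j] with [f s < j].

    Deleting the last element, and keeping as pending the elements whose parent
    is still to be chosen, gives a recurrence for the weighted number [S n h] of
    configurations with [n] elements and [h] pending ones. The series
    [K h = m ^ h (1 + M)] satisfy the transposed recurrence, whence
    [\sum_h S a h * [z^(n - a)] (K h)] does not depend on [a]. Its values at
    [a = 0] and [a = n] are [[z^n] (1 + M)] and the sum over all partitions. *)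

(** * Sequences of parents *)

(** The entries of [s1] occupy the positions from [k] on, and those of [s2] come later: an entry [y]
    of [s2] with [x < y < k] starts an arc that crosses the arc from [x] to [k]. *)
Fixpoint uncrossed k (s1 s2 : seq nat) : bool :=
  if s1 is x :: s then all (fun y => ~~ (x < y < k)) s2 && uncrossed k.+1 s s2
  else true.

Fixpoint parent_seq k (s : seq nat) : bool :=
  if s is x :: s' then
    [&& x <= k, all (fun y => ~~ (x < y < k)) s' & parent_seq k.+1 s']
  else true.

Lemma parent_seqP k s :
  reflect [/\ forall i, i < size s -> nth 0 s i <= k + i
            & forall i j, i < j < size s ->
                ~~ (nth 0 s i < nth 0 s j < k + i)]
          (parent_seq k s).
Proof.
elim: s k => [|x s IHs] k /=; first by constructor; split=> // i j; rewrite ltn0 andbF.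
apply: (iffP and3P) => [[lexk /allP xs /IHs[le_s nc_s]]|[le_s nc_s]].
  split=> [[|i] /= lti|[|i] [|j] //= ltij].
  - by rewrite addn0.
  - by rewrite addnS -addSn le_s.
  - by rewrite addn0; apply/xs/mem_nth.
  - by rewrite addnS -addSn nc_s.
split; first by have := le_s 0 isT; rewrite addn0.
  apply/allP=> y /(nthP 0)[j ltj <-].
  by have := nc_s 0 j.+1 ltj; rewrite addn0.
apply/IHs; split=> [i lti|i j ltij].
  by rewrite addSn -addnS; apply: (le_s i.+1).
by rewrite addSn -addnS; apply: (nc_s i.+1 j.+1).
Qed.

Lemma uncrossed_catr k s1 s2 s3 :
  uncrossed k s1 (s2 ++ s3) = uncrossed k s1 s2 && uncrossed k s1 s3.
Proof.
by elim: s1 k => //= x s IHs k; rewrite all_cat IHs andbACA.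
Qed.

Lemma parent_seq_cat k s1 s2 :
  parent_seq k (s1 ++ s2) =
    [&& parent_seq k s1, uncrossed k s1 s2 & parent_seq (k + size s1) s2].
Proof.
elim: s1 k => [|x s IHs] k /=; first by rewrite addn0.
rewrite IHs all_cat addSnnS -!andbA; do 2!congr (_ && _).
by rewrite andbCA; congr (_ && _); rewrite andbCA.
Qed.

Lemma uncrossed_nseqr k s d n : k + size s <= n.+1 -> uncrossed k s (nseq d n).
Proof.
elim: s k => //= x s IHs k; rewrite addnS => lekn.
rewrite IHs ?addSn // andbT all_nseq; lia.
Qed.

Lemma uncrossed_nseql k d n s : all (fun y => y <= n) s -> uncrossed k (nseq d n) s.
Proof.
move=> les; elim: d k => //= d IHd k; rewrite IHd andbT.
by apply: sub_all les => y; lia.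
Qed.

Lemma parent_seq_nseq k d n : n <= k -> parent_seq k (nseq d n).
Proof.
elim: d k => //= d IHd k lenk; rewrite lenk IHd ?(leqW lenk) // andbT all_nseq; lia.
Qed.

(** When all positions are at least [n] and all entries below [n], the comparisons with the position
    are settled; what remains is that the entries decrease weakly, whatever the position. *)
Lemma parent_seq_shift n k k' s : all (fun y => y < n) s ->
  n <= k -> n <= k' -> parent_seq k s = parent_seq k' s.
Proof.
elim: s k k' => //= x s IHs k k' /andP[ltx lts] lek lek'.
rewrite (IHs k.+1 k'.+1) ?leqW //; congr (_ && (_ && _)); first by lia.
by apply: eq_in_all => y /(allP lts); lia.
Qed.

(* Entries equal to [n] at positions [> n] (children of [n]) never cross the other
   arcs, so they can be inserted or removed right after the entries of the first
   elements. *)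
Lemma parent_seq_insert n d s r : n <= size s <= n.+1 -> all (fun y => y < n) r ->
  parent_seq 0 (s ++ nseq d n ++ r) = parent_seq 0 (s ++ r).
Proof.
move=> /andP[les ges] ltr; rewrite !parent_seq_cat uncrossed_catr size_nseq.
rewrite uncrossed_nseqr // parent_seq_nseq // uncrossed_nseql /=; last first.
  by apply: sub_all ltr => y; apply: ltnW.
rewrite add0n (@parent_seq_shift n (size s + d) (size s)) //.
exact: leq_trans les (leq_addr _ _).
Qed.

Lemma parent_seq_bound k s : parent_seq k s -> all (fun y => y < k + size s) s.
Proof.
move=> /parent_seqP[les _]; apply/allP => y /(nthP 0)[i lti <-].
by apply: leq_ltn_trans (les i lti) _; rewrite ltn_add2l.
Qed.

(** Beyond position [n], an entry below [n] followed by an entry [n] would be a crossing, so the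
    copies of [n] come first. *)
Lemma parent_seq_split n k s : n < k -> all (fun y => y <= n) s -> parent_seq k s ->
  s = nseq (count_mem n s) n ++ [seq x <- s | x != n].
Proof.
elim: s k => //= x s IHs k ltnk /andP[lex les] /and3P[_ nc_x nc_s].
have /IHs -/(_ les nc_s) def_s: n < k.+1 by lia.
case: eqVneq => [-> /=|nex]; first by rewrite {1}def_s.
suff n's: n \notin s by rewrite (count_memPn n's) /= {1}def_s (count_memPn n's).
by apply/negP => /(allP nc_x); lia.
Qed.

(* The last [h] entries belong to the pending elements: their parents are among
   the first [n] elements. *)
Definition parent_seqs n h (s : seq nat) :=
  [&& size s == n + h, all (fun y => y < n) s & parent_seq 0 s].

(* The first list inserts [n'] as its own parent, followed by its [d] children;
   in the second list [n'] is the first pending element of [s] and only the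
   children are new. *)
Fixpoint parent_enum n h : seq (seq nat) :=
  if n is n'.+1 then
    [seq take n' s ++ nseq d.+1 n' ++ drop n' s
       | d <- iota 0 h.+1, s <- parent_enum n' (h - d)] ++
    [seq take n s ++ nseq d n' ++ drop n s
       | d <- iota 0 h.+1, s <- parent_enum n' (h - d).+1]
  else if h == 0 then [:: [::]] else [::].

Lemma parent_enumS n h : parent_enum n.+1 h =
    [seq take n s ++ nseq d.+1 n ++ drop n s
       | d <- iota 0 h.+1, s <- parent_enum n (h - d)] ++
    [seq take n.+1 s ++ nseq d n ++ drop n.+1 s
       | d <- iota 0 h.+1, s <- parent_enum n (h - d).+1].
Proof. by []. Qed.

(** With [count_insert], this recovers the old list and the number [d] from the result of an
    insertion, whence the injectivity in [parent_enum_uniq]. *)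
Lemma filter_neq_insert n d (s r : seq nat) :
  all (fun y => y < n) s -> all (fun y => y < n) r ->
  [seq x <- s ++ nseq d n ++ r | x != n] = s ++ r.
Proof.
move=> lts ltr; rewrite !filter_cat filter_nseq eqxx /=.
by congr (_ ++ _); apply/all_filterP; [apply: sub_all lts|apply: sub_all ltr] => y; lia.
Qed.

Lemma count_insert n d (s r : seq nat) :
  all (fun y => y < n) s -> all (fun y => y < n) r ->
  count_mem n (s ++ nseq d n ++ r) = d.
Proof.
move=> lts ltr; rewrite !count_cat count_nseq /= eqxx mul1n.
rewrite !(count_memPn _) ?addn0 //; apply/negP.
  by move/(allP ltr); rewrite ltnn.
by move/(allP lts); rewrite ltnn.
Qed.

Lemma all_take_drop (T : eqType) (P : pred T) n s :
  all P s -> all P (take n s) && all P (drop n s).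
Proof. by rewrite -all_cat cat_take_drop. Qed.

Lemma mem_parent_enum (n h : nat) (s : seq nat) : (s \in parent_enum n h) = parent_seqs n h s.
Proof.
elim: n h s => [|n IHn] h s.
  rewrite /parent_seqs add0n.
  have -> : all (fun y => y < 0) s = (s == [::]) by case: s.
  by case: h s => [|h] [|x s] //=; rewrite ?inE ?andbF.
rewrite parent_enumS mem_cat; apply/orP/idP.
  case=> /allpairsPdep[d [s' [dh]]]; rewrite IHn => /and3P[/eqP sz lts pss] ->.
    have /andP[lt1 lt2] := all_take_drop n lts.
    apply/and3P; split.
    - by rewrite !size_cat size_nseq size_drop size_takel; move: dh; rewrite ?mem_iota; lia.
    - rewrite !all_cat all_nseq; do 2?[apply/andP; split].
      + by apply: sub_all lt1 => y; lia.
      + lia.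
      + by apply: sub_all lt2 => y; lia.
    - by rewrite parent_seq_insert ?cat_take_drop // size_takel ?leqnn ?leqnSn; lia.
  have /andP[lt1 lt2] := all_take_drop n.+1 lts.
  apply/and3P; split.
  - by rewrite !size_cat size_nseq size_drop size_takel; move: dh; rewrite ?mem_iota; lia.
  - rewrite !all_cat all_nseq; do 2?[apply/andP; split].
    + by apply: sub_all lt1 => y; lia.
    + lia.
    + by apply: sub_all lt2 => y; lia.
  - by rewrite parent_seq_insert ?cat_take_drop // size_takel ?leqnn ?leqnSn; lia.
case/and3P => /eqP sz lts pss.
have szt : size (take n s) = n by rewrite size_takel; lia.
(* Here [take n s] holds the parents of the earlier elements, [x] the parent of the element [n], and
   [r] those of the [h] pending elements. *)
case def_s: (drop n s) => [|x r].
  by have := congr1 size def_s; rewrite size_drop /=; lia.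
have szr : size r = h by have := congr1 size def_s; rewrite size_drop /=; lia.
have := pss; rewrite -{1}(cat_take_drop n s) parent_seq_cat def_s szt add0n.
case/and3P=> /parent_seq_bound lt1 _ /and3P[_ _ psr].
rewrite szt add0n in lt1.
have := lts; rewrite -{1}(cat_take_drop n s) all_cat def_s => /and3P[_ ltx ltr].
have [d [r' [def_r ltr' szr']]] : exists d (r' : seq nat),
    [/\ r = nseq d n ++ r', all (fun y => y < n) r' & d + size r' = h].
  have def_r := parent_seq_split (ltnSn n) ltr psr.
  exists (count_mem n r), [seq y <- r | y != n]; split=> //.
    apply/allP => y; rewrite mem_filter => /andP[nyn /(allP ltr)].
    by rewrite ltnS leq_eqVlt (negPf nyn).
  by rewrite -szr [in RHS]def_r size_cat size_nseq.
have def_s' : s = take n s ++ x :: nseq d n ++ r'.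
  by rewrite -def_r -def_s cat_take_drop.
(* If [n] is its own parent, its entry is removed along with those of its [d] children. Otherwise
   only the children's entries go, and [x], being below [n], stays as the entry of a pending
   element. *)
case: (eqVneq x n) => [exn|nex].
  have def_s2 : s = take n s ++ nseq d.+1 n ++ r' by rewrite {1}def_s' exn.
  left; apply/allpairsPdep; exists d, (take n s ++ r'); split.
  - by rewrite mem_iota; lia.
  - rewrite IHn; apply/and3P; split.
    + by rewrite size_cat szt; lia.
    + by rewrite all_cat lt1.
    + by rewrite -(@parent_seq_insert n d.+1) ?szt ?leqnn ?leqnSn // -def_s2.
  - by rewrite take_size_cat // drop_size_cat.
have szx : size (rcons (take n s) x) = n.+1 by rewrite size_rcons szt.
have def_s2 : s = rcons (take n s) x ++ nseq d n ++ r' by rewrite cat_rcons.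
right; apply/allpairsPdep; exists d, (rcons (take n s) x ++ r'); split.
- by rewrite mem_iota; lia.
- rewrite IHn; apply/and3P; split.
  + by rewrite size_cat szx; lia.
  + by rewrite all_cat all_rcons lt1 ltr' !andbT; lia.
  + by rewrite -(@parent_seq_insert n d) ?szx ?leqnn ?leqnSn // -def_s2.
- by rewrite take_size_cat // drop_size_cat.
Qed.

Lemma parent_enum_uniq (n h : nat) : uniq (parent_enum n h).
Proof.
elim: n h => [|n IHn] h; first by rewrite /=; case: ifP.
have lt_enum k s m : s \in parent_enum n k ->
    all (fun y => y < n) (take m s) /\ all (fun y => y < n) (drop m s).
  by rewrite mem_parent_enum => /and3P[_ lts _]; apply/andP/all_take_drop.
have inj e m k : {in [seq @Tagged nat d (fun=> seq nat) s
      | d <- iota 0 h.+1, s <- parent_enum n (k d)] &,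
    injective (fun p : {_ : nat & seq nat} =>
      take m (tagged p) ++ nseq (e + tag p) n ++ drop m (tagged p))}.
  move=> p q /allpairsPdep[d [s [_ /lt_enum-/(_ m)[lt1 lt2] ->]]].
  move=> /allpairsPdep[d' [s' [_ /lt_enum-/(_ m)[lt1' lt2'] ->]]] /= eq_ds.
  have := congr1 (count_mem n) eq_ds; rewrite !count_insert // => /addnI ->.
  have := congr1 (filter (fun x => x != n)) eq_ds.
  by rewrite !filter_neq_insert // !cat_take_drop => ->.
rewrite parent_enumS cat_uniq; apply/and3P; split.
- apply: allpairs_uniq_dep => // [|p q pP qP]; first exact: iota_uniq.
  exact: (inj 1 n (fun d => h - d)).
(* The two halves are disjoint: the entry at position [n] is [n] in the first and less than [n] in
   the second. *)
- apply/negP => /hasP[_ /allpairsPdep[d [s [_ sP ->]]]].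
  case/allpairsPdep=> d' [s' [_ s'P]].
  move: sP s'P; rewrite !mem_parent_enum.
  move=> /and3P[/eqP sz lts _] /and3P[/eqP sz' lts' _] /(congr1 (nth 0 ^~ n)).
  rewrite nth_cat size_takel ?ltnSn /=; last by lia.
  rewrite nth_cat size_takel ?ltnn ?subnn /=; last by lia.
  rewrite nth_take // => eqn.
  have: nth 0 s n \in s by apply/mem_nth; rewrite sz addnS ltnS leq_addr.
  by move/(allP lts); rewrite eqn ltnn.
- apply: allpairs_uniq_dep => // [|p q pP qP]; first exact: iota_uniq.
  exact: (inj 0 n.+1 (fun d => (h - d).+1)).
Qed.

(** * Weights of elements and the recurrence on the number of elements *)

Section ElementWeight.
Variables (C : comNzRingType) (t ct : nat -> C).
Local Open Scope ring_scope.

(** The test starts at position [j] itself, so a child of an earlier element gets [t]; it also sees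
    the pending entries at the end of [s]. The subtraction keeps [j] from counting as its own
    child. *)
Definition element_weight (s : seq nat) j : C :=
  (if has (fun x => x < j)%N (drop j s) then t else ct)
    (count_mem j s - (nth 0%N s j == j))%N.

Definition pending_sum n h : C :=
  \sum_(s <- parent_enum n h) \prod_(j < n) element_weight s j.

(** The inserted entries equal [n > j]: they are not children of [j], do not pass below [j], and
    leave the entries up to position [j] in place. *)
Lemma element_weight_insert n d m (s : seq nat) j : (j < n)%N -> (n <= m)%N ->
  (n <= size s)%N ->
  element_weight (take m s ++ nseq d n ++ drop m s) j = element_weight s j.
Proof.
move=> ltjn lenm lens; rewrite /element_weight.
have ltj : (j < size (take m s))%N by rewrite size_take_min; lia.
have -> : count_mem j (take m s ++ nseq d n ++ drop m s) = count_mem j s.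
  rewrite -[in RHS](cat_take_drop m s) !count_cat count_nseq /=.
  by rewrite (_ : (n == j) = false) ?mul0n ?add0n //; lia.
rewrite nth_cat ltj nth_take; last by lia.
rewrite drop_cat ltj !has_cat has_nseq (_ : (n < j)%N = false) ?andbF; last by lia.
rewrite -[in RHS](cat_take_drop m s) drop_cat ltj has_cat orFb.
by rewrite cat_take_drop.
Qed.

Lemma pending_sum0 h : pending_sum 0 h = (h == 0%N)%:R.
Proof.
by rewrite /pending_sum /=; case: h => [|h]; rewrite ?big_seq1 ?big_nil ?big_ord0.
Qed.

(** Here [d] is the number of children of the new element [n]; the other [h - d] pending elements
    have parents before [n]. If [n] is its own parent, it is exterior exactly when [h - d = 0]. If
    it is a child, it joins the pending elements of the smaller configuration and gets [t d]. *)
Lemma pending_sumS n h : pending_sum n.+1 h =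
  \sum_(d < h.+1) ((if (h - d)%N == 0%N then ct d else t d) * pending_sum n (h - d)%N
                   + t d * pending_sum n (h - d).+1%N).
Proof.
rewrite /pending_sum parent_enumS big_cat !big_allpairs_dep big_split.
rewrite -[iota 0 h.+1]/(index_iota 0 h.+1) !big_mkord.
congr (_ + _); apply: eq_bigr => d _; rewrite mulr_sumr big_seq [in RHS]big_seq;
  apply: eq_bigr => s; rewrite mem_parent_enum => /and3P[/eqP sz lts _].
  have /andP[lt1 lt2] := all_take_drop n lts.
  have szt : size (take n s) = n by rewrite size_takel // sz leq_addr.
  rewrite big_ord_recr mulrC /=; congr (_ * _).
    by apply: eq_bigr => j _; rewrite (@element_weight_insert n d.+1 n) ?ltn_ord //; lia.
  rewrite /element_weight -[_ :: _]/(nseq d.+1 n ++ drop n s) count_insert //.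
  rewrite nth_cat szt ltnn subnn /= eqxx subn1 /= drop_size_cat // /= ltnn /=.
  rewrite has_cat has_nseq ltnn andbF /=.
  have sz2 : size (drop n s) = (h - d)%N by rewrite size_drop sz addKn.
  case: (drop n s) sz2 lt2 => [|x r] /= <- //.
  by case/andP => -> _.
have /andP[lt1 lt2] := all_take_drop n.+1 lts.
have szt : size (take n.+1 s) = n.+1 by rewrite size_takel // sz addnS ltnS leq_addr.
rewrite big_ord_recr mulrC /=; congr (_ * _).
  by apply: eq_bigr => j _; rewrite element_weight_insert ?ltn_ord //; lia.
have ltn : (nth 0%N s n < n)%N
  by apply: (allP lts); apply: mem_nth; rewrite sz addnS ltnS leq_addr.
rewrite /element_weight count_insert // nth_cat szt ltnSn nth_take //.
rewrite (ltn_eqF ltn) subn0 drop_cat szt ltnSn (drop_nth 0%N) ?szt //=.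
by rewrite nth_take // ltn.
Qed.

End ElementWeight.

(** * Linked partitions and their parent functions *)

Section Blocks.
Variable n : nat.
Implicit Types (B D : {set 'I_n}) (g : {set {set 'I_n}}) (f : 'I_n -> 'I_n).

Lemma is_minP B i :
  reflect (i \in B /\ forall j, j \in B -> i <= j) (is_min B i).
Proof.
apply: (iffP andP) => [[iB /forall_inP]|[iB le_i]]; first by split.
by split=> //; apply/forall_inP.
Qed.

Lemma is_min_inj B i j : is_min B i -> is_min B j -> i = j.
Proof.
move=> /is_minP[iB lei] /is_minP[jB lej]; apply/val_inj/eqP.
by rewrite eqn_leq lei ?lej.
Qed.

Lemma is_min_exists B : B != set0 -> exists i, is_min B i.
Proof.
case/set0Pn => x xB; case: (arg_minnP (fun i : 'I_n => i : nat) xB) => i iB lei.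
by exists i; apply/is_minP.
Qed.

Lemma crossingP B D :
  reflect (exists i k p q, [/\ i \in B, k \in D, p \in B & q \in D] /\ i < k < p /\ p < q)
          (crossing B D).
Proof.
apply: (iffP exists_inP) => [[i iB /exists_inP[k kD /exists_inP[p pB /exists_inP[q qD]]]]|].
  by case/and3P => ik kp pq; exists i, k, p, q; rewrite ik.
case=> i [k [p [q [[iB kD pB qD] [/andP[ik kp] pq]]]]]; exists i => //.
apply/exists_inP; exists k => //; apply/exists_inP; exists p => //.
by apply/exists_inP; exists q => //; apply/and3P.
Qed.

Lemma linkedC B D : linked B D = linked D B.
Proof.
rewrite /linked setIC; congr (_ || _); apply: eq_existsb => j.
by rewrite addbC; do 2!case: (1 < _); rewrite ?andbF.
Qed.

(** In a non-crossing linked partition, [j] is non-minimal in at most one of its blocks, so the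
    least element sharing a block with [j] is the minimum of that block, or [j] itself if there is
    none. *)
Definition parent g (j : 'I_n) : 'I_n :=
  [arg min_(i < j | [exists B in g, (i \in B) && (j \in B)]) (i : nat)].

Definition family f (i : 'I_n) : {set 'I_n} := [set j | (j == i) || (f j == i)].

(** Only values of [f] head a block. Any other element has no children, and its singleton family
    must not become a block. *)
Definition families f : {set {set 'I_n}} := [set family f i | i in f @: 'I_n].

Section OfPartition.
Variable g : {set {set 'I_n}}.
Hypothesis gP : g \in NCL n.

Lemma NCL_neq0 B : B \in g -> B != set0.
Proof.
move: gP; rewrite inE => /and3P[n0 _ _] Bg.
by apply: contraNneq n0 => <-.
Qed.

Lemma NCL_cover j : exists2 B, B \in g & j \in B.
Proof.
move: gP; rewrite inE => /and3P[_ /eqP cov _].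
have /bigcupP[B Bg jB] : j \in cover g by rewrite cov inE.
by exists B.
Qed.

Lemma NCL_pair B D : B \in g -> D \in g -> B != D -> ~~ crossing B D /\ linked B D.
Proof.
move: gP; rewrite inE => /and3P[_ _ /forall_inP H] Bg Dg neq.
by have /forall_inP/(_ D Dg)/implyP/(_ neq)/andP := H B Bg.
Qed.

Lemma NCL_common B D j : B \in g -> D \in g -> B != D -> j \in B -> j \in D ->
  [/\ 1 < #|B|, 1 < #|D| & is_min B j (+) is_min D j].
Proof.
move=> Bg Dg neq jB jD; have [_ /orP[/eqP I0|/existsP[k]]] := NCL_pair Bg Dg neq.
  have : j \in B :&: D by rewrite inE jB.
  by rewrite I0 inE.
case/and4P => /eqP defI cB cD m; suff -> : j = k by [].
by apply/set1P; rewrite -defI inE jB.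
Qed.

Lemma NCL_min_inj B D j : B \in g -> D \in g -> is_min B j -> is_min D j -> B = D.
Proof.
move=> Bg Dg mB mD; apply/eqP/negPn/negP => neq.
have [jB _] := is_minP _ _ mB; have [jD _] := is_minP _ _ mD.
by case: (NCL_common Bg Dg neq jB jD) => _ _; rewrite mB mD.
Qed.

Lemma parentP j : exists B, [/\ B \in g, is_min B (parent g j) & j \in B].
Proof.
rewrite /parent; case: arg_minnP => [|i].
  by have [B Bg jB] := NCL_cover j; apply/exists_inP; exists B; rewrite ?jB.
case/exists_inP => B Bg /andP[iB jB] mini; exists B; split=> //.
apply/is_minP; split=> // k kB; apply: mini.
by apply/exists_inP; exists B => //; rewrite kB.
Qed.

Lemma parent_min B i j : B \in g -> i \in B -> j \in B -> parent g j <= i.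
Proof.
move=> Bg iB jB; rewrite /parent; case: arg_minnP => [|k _ mink].
  by apply/exists_inP; exists B; rewrite ?jB.
by apply: mink; apply/exists_inP; exists B => //; rewrite iB.
Qed.

Lemma parent_le j : parent g j <= j.
Proof. by have [B [Bg _ jB]] := parentP j; apply: (parent_min Bg). Qed.

(** Let [D] be the block headed by the parent of [j]. If [D] differs from [B], then [j], non-minimal
    in [B], is the minimum of [D] and hence its own parent, although [B] offers the smaller
    candidate [i]. *)
Lemma parent_of_min B i j : B \in g -> is_min B i -> j \in B -> j != i ->
  parent g j = i.
Proof.
move=> Bg mi jB neji; have [iB lei] := is_minP _ _ mi.
have [D [Dg mD jD]] := parentP j.
case: (eqVneq B D) => [eBD|neq].
  by apply: is_min_inj mD _; rewrite -eBD.
have [_ _] := NCL_common Bg Dg neq jB jD.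
case mBj: (is_min B j).
  by rewrite (is_min_inj mBj mi) eqxx in neji.
move=> /= mDj; have ej := is_min_inj mD mDj.
have := parent_min Bg iB jB; rewrite ej => leji.
by case/negP: neji; apply/eqP/val_inj/eqP; rewrite eqn_leq leji lei.
Qed.

Lemma family_of_min B i : B \in g -> is_min B i -> family (parent g) i = B.
Proof.
move=> Bg mi; have [iB _] := is_minP _ _ mi.
apply/setP => j; rewrite inE; apply/orP/idP => [[/eqP->//|/eqP eji]|jB].
  have [D [Dg mD jD]] := parentP j.
  by rewrite eji in mD; rewrite (NCL_min_inj Bg Dg mi mD).
by case: (eqVneq j i) => [|neji]; [left|right; rewrite (parent_of_min Bg mi)].
Qed.

Lemma families_parent : families (parent g) = g.
Proof.
apply/setP => B; apply/imsetP/idP => [[i /imsetP[j _ ->] ->]|Bg].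
  by have [D [Dg mD jD]] := parentP j; rewrite (family_of_min Dg mD).
have [i mi] := is_min_exists (NCL_neq0 Bg).
exists i; last by rewrite (family_of_min Bg mi).
have [iB lei] := is_minP _ _ mi.
have [D [Dg mD iD]] := parentP i.
apply/imsetP; case: (eqVneq B D) => [eBD|neq].
  by exists i => //; rewrite -eBD in mD; apply: is_min_inj mi mD.
(* Since [i] lies in a second block, [B] has at least two elements, and any element of [B] other
   than [i] has parent [i]. *)
have [cB _ _] := NCL_common Bg Dg neq iB iD.
have [j jB neji] : exists2 j, j \in B & j != i.
  move: cB; rewrite (cardsD1 i) iB add1n ltnS card_gt0 => /set0Pn[j].
  by rewrite !inE => /andP[]; exists j.
by exists j => //; rewrite (parent_of_min Bg mi).
Qed.

Lemma parent_noncrossing (p q : 'I_n) : p < q -> ~~ (parent g p < parent g q < p).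
Proof.
move=> ltpq; apply/negP => /andP[lt1 lt2].
have [B [Bg mB pB]] := parentP p; have [D [Dg mD qD]] := parentP q.
have neq : B != D.
  by apply: contraTneq lt1 => eBD; rewrite -eBD in mD; rewrite (is_min_inj mB mD) ltnn.
have [/crossingP nc _] := NCL_pair Bg Dg neq; apply: nc.
have [iB _] := is_minP _ _ mB; have [kD _] := is_minP _ _ mD.
by exists (parent g p), (parent g q), p, q; rewrite lt1.
Qed.

End OfPartition.

Section OfParents.
Variable f : 'I_n -> 'I_n.
Hypothesis f_le : forall j, f j <= j.
Hypothesis f_nc : forall p q : 'I_n, p < q -> ~~ (f p < f q < p).

Lemma family_min i : is_min (family f i) i.
Proof.
apply/is_minP; split=> [|j]; first by rewrite inE eqxx.
by rewrite inE => /orP[/eqP->//|/eqP<-].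
Qed.

Lemma family_inj : injective (family f).
Proof.
move=> i j eij; apply: is_min_inj (family_min i) _.
by rewrite eij family_min.
Qed.

Lemma family_child i j : j \in family f i -> i < j -> f j = i.
Proof. by rewrite inE => /orP[/eqP->|/eqP//]; rewrite ltnn. Qed.

Lemma family_parent j : j \in family f (f j).
Proof. by rewrite inE eqxx orbT. Qed.

Lemma mem_families j : family f (f j) \in families f.
Proof. by apply/imset_f/imset_f. Qed.

Lemma parent_families j : parent (families f) j = f j.
Proof.
rewrite /parent; case: arg_minnP => [|i].
  apply/exists_inP; exists (family f (f j)); first exact: mem_families.
  by rewrite !family_parent.
case/exists_inP => _ /imsetP[k _ ->] /andP[ik jk] mini.
apply/val_inj/eqP; rewrite eqn_leq /= mini /=; last first.
  apply/exists_inP; exists (family f (f j)); first exact: mem_families.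
  by rewrite family_parent andbT; case/is_minP: (family_min (f j)).
have [_ /(_ i ik) leki] := is_minP _ _ (family_min k).
by move: jk; rewrite inE => /orP[/eqP->|/eqP->//]; apply: leq_trans (f_le k) leki.
Qed.

(** In a crossing [x < y < z < w], neither [z] nor [w] is a minimum, so their parents are [i] and
    [k]. If [i < k], the pair [z], [w] violates [f_nc]. If [k < i], then [y] is not a minimum
    either, and the pair [y], [z] violates it. *)
Lemma family_not_crossing i k : i != k -> ~~ crossing (family f i) (family f k).
Proof.
move=> neik; apply/crossingP => -[x [y [z [w [[xi yk zi wk] [/andP[xy yz] zw]]]]]].
have [_ lei] := is_minP _ _ (family_min i); have [_ lek] := is_minP _ _ (family_min k).
have {}lei := lei _ xi; have {}lek := lek _ yk.
have fz : f z = i by apply: family_child => //; lia.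
have fw : f w = k by apply: family_child => //; lia.
case: (ltngtP i k) => [ltik|ltki|/val_inj eik]; last by rewrite eik eqxx in neik.
  by have := f_nc zw; rewrite fz fw; lia.
have fy : f y = k by apply: family_child => //; lia.
by have := f_nc yz; rewrite fz fy; lia.
Qed.

(** The only possible common element is the larger head [k], and then [k] is a child of [i]. Its
    family has a second element [b], because [b = k] would make [k] its own parent. *)
Lemma family_linked a b : f a < f b -> linked (family f (f a)) (family f (f b)).
Proof.
set i := f a; set k := f b => ltik.
have sub j : j \in family f i -> j \in family f k -> j = k /\ f k = i.
  rewrite !inE => /orP[/eqP->|/eqP fj]; last first.
    case/orP=> [/eqP ejk|/eqP fjk]; first by rewrite -ejk.
    by move: ltik; rewrite -fj fjk ltnn.
  case/orP => [/eqP eik|/eqP fik]; first by rewrite eik ltnn in ltik.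
  by have := f_le i; rewrite fik leqNgt ltik.
rewrite /linked; case: eqVneq => //= /set0Pn[j /setIP[ji jk]].
have [_ fk] := sub j ji jk.
have ki : k \in family f i by rewrite inE fk eqxx orbT.
have kk : k \in family f k by rewrite inE eqxx.
have ii : i \in family f i by rewrite inE eqxx.
have ne : i != k by apply: contraTneq ltik => ->; rewrite ltnn.
apply/existsP; exists k; apply/and4P; split.
- apply/eqP/setP => x; rewrite in_set1 in_setI.
  by apply/andP/eqP => [[xi xk]|->//]; case: (sub x xi xk).
- have /subset_leq_card : [set i; k] \subset family f i by rewrite subUset !sub1set ii ki.
  by rewrite cards2 ne.
- have /subset_leq_card : [set b; k] \subset family f k.
    by rewrite subUset !sub1set kk family_parent.
  suff nb: b != k by rewrite cards2 nb.
  by apply: contraNneq ne => eb; rewrite -fk -{1}eb.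
- rewrite family_min addbT; apply/negP => mk.
  by rewrite (is_min_inj mk (family_min i)) eqxx in ne.
Qed.

Lemma families_NCL : families f \in NCL n.
Proof.
rewrite inE; apply/and3P; split.
- apply/imsetP => -[i _ e0]; have [] := is_minP _ _ (family_min i).
  by rewrite -e0 inE.
- apply/eqP/setP => j; rewrite inE; apply/bigcupP.
  by exists (family f (f j)); [apply: mem_families|apply: family_parent].
- apply/forall_inP => _ /imsetP[_ /imsetP[a _ ->] ->].
  apply/forall_inP => _ /imsetP[_ /imsetP[b _ ->] ->].
  apply/implyP => neq; have ne : f a != f b by apply: contraNneq neq => ->.
  rewrite family_not_crossing //=.
  case: (ltngtP (f a) (f b)) => [ltab|ltba|/val_inj eab]; last by rewrite eab eqxx in ne.
    exact: family_linked.
  by rewrite linkedC family_linked.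
Qed.

(** If a block headed by [k] has elements [l < i <= s], then [k <= l < s], so [s] is a child of [k]
    and its parent is below [i]. Conversely, [l] can be taken to be the parent of [s]. *)
Lemma exterior_family i :
  exterior (families f) (family f i) = ~~ [exists s : 'I_n, f s < i <= s].
Proof.
congr (~~ _); apply/exists_inP/existsP => [[_ /imsetP[k _ ->] /andP[neq]]|[s /andP[lts les]]].
  case/existsP => b /andP[mb /exists_inP[l lk /exists_inP[s sk]]].
  rewrite (is_min_inj mb (family_min i)) => /andP[ltl les].
  have [_ /(_ _ lk) lekl] := is_minP _ _ (family_min k).
  by exists s; rewrite (family_child sk) ?les ?andbT; lia.
exists (family f (f s)); first exact: mem_families.
apply/andP; split.
  by apply: contraTneq lts => /family_inj->; rewrite ltnn.
apply/existsP; exists i; rewrite family_min; apply/exists_inP; exists (f s).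
  by case/is_minP: (family_min (f s)).
by apply/exists_inP; exists s; rewrite ?family_parent // lts.
Qed.

Definition list_of : seq nat := [seq val (f j) | j <- enum 'I_n].

Lemma size_list_of : size list_of = n.
Proof. by rewrite size_map size_enum_ord. Qed.

Lemma nth_list_of (j : 'I_n) : nth 0 list_of j = f j.
Proof. by rewrite (nth_map j) ?size_enum_ord // nth_ord_enum. Qed.

Lemma nth_list_of_ltn k (ltk : k < n) : nth 0 list_of k = f (Ordinal ltk).
Proof. exact: (nth_list_of (Ordinal ltk)). Qed.

Lemma list_of_parent_seqs : parent_seqs n 0 list_of.
Proof.
apply/and3P; split; first by rewrite size_list_of addn0.
  by apply/allP => _ /mapP[j _ ->]; apply: ltn_ord.
apply/parent_seqP; rewrite size_list_of; split=> [i lti|i j /andP[ltij ltj]].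
  by rewrite (nth_list_of_ltn lti) add0n f_le.
have lti := ltn_trans ltij ltj.
rewrite (nth_list_of_ltn lti) (nth_list_of_ltn ltj) add0n.
exact: f_nc.
Qed.

Lemma has_drop_list_of (i : 'I_n) :
  has (fun x => x < i) (drop i list_of) = [exists s : 'I_n, f s < i <= s].
Proof.
apply/(has_nthP 0)/existsP => [[k]|[s /andP[lts les]]].
  rewrite size_drop size_list_of => ltk; rewrite nth_drop.
  have lts : i + k < n by lia.
  rewrite (nth_list_of_ltn lts) => ltf.
  by exists (Ordinal lts); rewrite ltf leq_addr.
exists (s - i); rewrite ?size_drop ?size_list_of; first by have := ltn_ord s; lia.
by rewrite nth_drop subnKC // nth_list_of.
Qed.

Lemma count_list_of (i : 'I_n) :
  count_mem (i : nat) list_of - (nth 0 list_of i == i) = #|family f i|.-1.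
Proof.
have -> : count_mem (i : nat) list_of = #|[set j | f j == i]|.
  rewrite count_map -sum1_count big_enum_cond -sum1_card /=.
  by apply: eq_bigl => j; rewrite inE.
rewrite nth_list_of (cardsD1 i (family f i)) (cardsD1 i [set j | f j == i]).
rewrite !inE eqxx (inj_eq val_inj) addKn.
by congr #|pred_of_set _|; apply/setP => j; rewrite !inE; case: eqP.
Qed.

Section Weight.
Local Open Scope ring_scope.
Variables (C : comNzRingType) (t ct : nat -> C).

Definition partition_weight g : C :=
  t 0%N ^+ (n - #|g|) * (\prod_(B in ext g) ct #|B|.-1) *
  (\prod_(B in int_blocks g) t #|B|.-1).

Lemma partition_weight_families :
  partition_weight (families f) = \prod_(j < n) element_weight t ct list_of j.
Proof.
have ew (i : 'I_n) : element_weight t ct list_of i =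
    (if exterior (families f) (family f i) then ct else t) #|family f i|.-1.
  rewrite /element_weight has_drop_list_of count_list_of exterior_family.
  by case: [exists s : 'I_n, _].
rewrite (eq_bigr _ (fun i _ => ew i)) {ew}.
(* The elements in the image of [f] correspond to the blocks. Each of the [n - #|g|] others has a
   smaller parent and no child, so it is interior and contributes [t 0]. *)
rewrite (bigID (mem (f @: 'I_n))) /= mulrC /partition_weight -mulrA; congr (_ * _).
  have -> : (n - #|families f|)%N = #|~: (f @: 'I_n)|.
    by rewrite [RHS]cardsCs setCK card_ord card_imset //; apply: family_inj.
  rewrite -prodr_const; apply: eq_big => [i|i]; first by rewrite inE.
  rewrite inE => inI.
  have fi : (f i < i)%N.
    rewrite ltn_neqAle f_le andbT; apply: contraNneq inI => /val_inj <-.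
    exact: imset_f.
  rewrite exterior_family (_ : [exists s : 'I_n, _]); last first.
    by apply/existsP; exists i; rewrite fi /=.
  rewrite /= (_ : family f i = [set i]) ?cards1 //.
  apply/setP => j; rewrite !inE; case: (f j =P i) => [fj|_]; last by rewrite orbF.
  by case/imsetP: inI; exists j.
rewrite -(big_imset (fun B =>
  (if exterior (families f) B then ct else t) #|B|.-1)) /=; last first.
  by move=> ? ? _ _; apply: family_inj.
rewrite [RHS](bigID (exterior (families f))) /=; congr (_ * _).
  apply: eq_big => [B|B]; first by rewrite /ext inE.
  by rewrite /ext inE => /andP[_ ->].
apply: eq_big => [B|B].
  by rewrite /int_blocks !inE; case: (B \in _); rewrite ?andbF ?andbT.
by rewrite /int_blocks !inE => /andP[] /nandP[/negP//|/negPf->].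
Qed.

End Weight.
End OfParents.
End Blocks.

(** * The sum over all partitions *)

Section Sum.
Local Open Scope ring_scope.
Variables (C : comNzRingType) (t ct : nat -> C) (n : nat).

(** For lists satisfying [parent_seqs n 0] all entries are below [n], so the default [j] is never
    taken. *)
Definition fun_of (s : seq nat) (j : 'I_n) : 'I_n := insubd j (nth 0%N s j).

Lemma fun_ofP s : parent_seqs n 0 s ->
  [/\ forall j, (fun_of s j <= j)%N,
      forall p q : 'I_n, (p < q)%N -> ~~ (fun_of s p < fun_of s q < p)%N
    & list_of (fun_of s) = s].
Proof.
case/and3P => /eqP; rewrite addn0 => sz lts /parent_seqP[le_s nc_s].
have val_f j : fun_of s j = nth 0%N s j :> nat.
  by rewrite val_insubd (allP lts) // mem_nth ?sz.
split=> [j|p q ltpq|]; first by rewrite val_f le_s // sz.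
  by rewrite !val_f (nc_s p q) // sz ltpq ltn_ord.
apply: (@eq_from_nth _ 0%N) => [|i]; rewrite size_list_of // => lti.
by rewrite (nth_list_of_ltn _ lti) val_f.
Qed.

Lemma list_of_inj (f f' : 'I_n -> 'I_n) : f =1 f' -> list_of f = list_of f'.
Proof. by move=> eq_f; apply: eq_map => j; rewrite eq_f. Qed.

(** The inverse sends a partition to the list of its parents: [families_parent] and
    [parent_families] are the two round trips. *)
Lemma families_perm :
  perm_eq [seq families (fun_of s) | s <- parent_enum n 0] (enum (NCL n)).
Proof.
apply: uniq_perm; rewrite ?enum_uniq //.
  rewrite map_inj_in_uniq ?parent_enum_uniq // => s s'; rewrite !mem_parent_enum.
  move=> /fun_ofP[le_s _ def_s] /fun_ofP[le_s' _ def_s'] eqf.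
  rewrite -def_s -def_s'; apply: list_of_inj => j.
  by rewrite -(parent_families le_s) -(parent_families le_s') eqf.
move=> g; rewrite mem_enum; apply/mapP/idP => [[s]|gP].
  by rewrite mem_parent_enum => /fun_ofP[le_s nc_s _] ->; apply: families_NCL.
have ps := list_of_parent_seqs (parent_le gP) (parent_noncrossing gP).
exists (list_of (parent g)); first by rewrite mem_parent_enum.
rewrite -{1}(families_parent gP); have [_ _ eql] := fun_ofP ps.
have eq_f : fun_of (list_of (parent g)) =1 parent g.
  by move=> j; apply/val_inj; rewrite /= -nth_list_of eql nth_list_of.
rewrite /families; have -> : parent g @: 'I_n = fun_of (list_of (parent g)) @: 'I_n.
  by apply: eq_imset => j; rewrite eq_f.
by apply: eq_imset => i; apply/setP => j; rewrite !inE eq_f.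
Qed.

Lemma sum_partition_weight :
  \sum_(g in NCL n) partition_weight t ct g = pending_sum t ct n 0.
Proof.
rewrite -big_enum /=; rewrite -(perm_big _ families_perm) big_map.
rewrite /pending_sum big_seq [RHS]big_seq; apply: eq_bigr => s.
rewrite mem_parent_enum => /fun_ofP[le_s _ def_s].
by rewrite partition_weight_families // def_s.
Qed.

End Sum.

(** * Formal power series *)

Local Open Scope ring_scope.

Section Truncation.
Variable C : fieldType.
Implicit Types (F G H : fps C) (p q : {poly C}).

(** Series are compared through polynomials modulo [z ^ N], so that the laws of multiplication and
    composition come from [{poly C}]. *)
Definition trunc N F : {poly C} := \poly_(i < N) F i.

Definition eq_upto N p q := forall i, (i < N)%N -> p`_i = q`_i.

Lemma coef_trunc N F i : (i < N)%N -> (trunc N F)`_i = F i.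
Proof. by rewrite coef_poly => ->. Qed.

Lemma fps_truncP F G : (forall N, eq_upto N (trunc N F) (trunc N G)) -> F =1 G.
Proof.
by move=> eqFG n; have := eqFG n.+1 n (ltnSn n); rewrite !coef_trunc.
Qed.

Lemma eq_upto_mul N p p' q q' :
  eq_upto N p p' -> eq_upto N q q' -> eq_upto N (p * q) (p' * q').
Proof.
move=> ep eq i lti; rewrite !coefM; apply: eq_bigr => j _.
by rewrite ep ?eq //; have := ltn_ord j; lia.
Qed.

Lemma eq_upto_exp N p q k : eq_upto N p q -> eq_upto N (p ^+ k) (q ^+ k).
Proof.
by move=> epq; elim: k => // k IHk; rewrite !exprS; apply: eq_upto_mul.
Qed.

Lemma coef_exp_small p k i : p`_0 = 0 -> (i < k)%N -> (p ^+ k)`_i = 0.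
Proof.
move=> p0; elim: k i => // k IHk i ltik; rewrite exprS coefM big1 // => -[[|j] ltj] _ /=.
  by rewrite p0 mul0r.
by rewrite IHk ?mulr0 //; lia.
Qed.

(** As [q] has no constant term, [q ^ k] has no coefficient of degree below [k], so the sum may stop
    at any bound above [i], independently of the size of [p]. *)
Lemma coef_comp_upto N p q i : q`_0 = 0 -> (i < N)%N ->
  (p \Po q)`_i = \sum_(k < N) p`_k * (q ^+ k)`_i.
Proof.
move=> q0 lti; rewrite coef_comp_poly.
rewrite (big_ord_widen (maxn N (size p)) (fun k => p`_k * (q ^+ k)`_i)) ?leq_maxr //.
rewrite [RHS](big_ord_widen (maxn N (size p)) (fun k => p`_k * (q ^+ k)`_i)) ?leq_maxl //.
rewrite big_mkcond [RHS]big_mkcond; apply: eq_bigr => k _ /=.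
case: ltnP => [_|lek]; case: ltnP => // lek'.
  by rewrite coef_exp_small ?mulr0 //; apply: leq_trans lti _.
by rewrite nth_default ?mul0r.
Qed.

Lemma eq_upto_comp N p p' q q' : q`_0 = 0 -> q'`_0 = 0 ->
  eq_upto N p p' -> eq_upto N q q' -> eq_upto N (p \Po q) (p' \Po q').
Proof.
move=> q0 q'0 ep eq i lti; rewrite !(@coef_comp_upto N) //.
by apply: eq_bigr => k _; rewrite ep // (eq_upto_exp _ eq).
Qed.

Lemma eq_upto_trans N p q r : eq_upto N p q -> eq_upto N q r -> eq_upto N p r.
Proof. by move=> epq eqr i lti; rewrite epq ?eqr. Qed.

Lemma eq_upto_sym N p q : eq_upto N p q -> eq_upto N q p.
Proof. by move=> epq i lti; rewrite epq. Qed.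

Lemma trunc_mul N F G : eq_upto N (trunc N (fps_mul F G)) (trunc N F * trunc N G).
Proof.
move=> i lti; rewrite coef_trunc // coefM; apply: eq_bigr => j _.
by rewrite !coef_trunc //; have := ltn_ord j; lia.
Qed.

Lemma trunc1 N : eq_upto N (trunc N (fps1 C)) 1.
Proof. by move=> i lti; rewrite coef_trunc // coef1. Qed.

Lemma trunc_exp N F k : eq_upto N (trunc N (fps_exp F k)) (trunc N F ^+ k).
Proof.
elim: k => [|k IHk]; first exact: trunc1.
rewrite exprS; apply: eq_upto_trans (trunc_mul _ _) _.
exact: eq_upto_mul.
Qed.

Lemma trunc_const N F : F 0%N = 0 -> (trunc N F)`_0 = 0.
Proof. by rewrite coef_poly => ->; case: ifP. Qed.

Lemma trunc_comp N F G : G 0%N = 0 ->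
  eq_upto N (trunc N (fps_comp F G)) (trunc N F \Po trunc N G).
Proof.
move=> G0 i lti; rewrite coef_trunc // (@coef_comp_upto i.+1) ?trunc_const //.
apply: eq_bigr => k _; rewrite coef_trunc ?(leq_trans (ltn_ord k)) //; congr (_ * _).
by rewrite -(@trunc_exp N G k) // coef_trunc.
Qed.

Lemma fps_comp_const F G : G 0%N = 0 -> fps_comp F G 0%N = F 0%N.
Proof. by rewrite /fps_comp big_ord1 mulr1. Qed.

Lemma fps_compA F G H : G 0%N = 0 -> H 0%N = 0 ->
  fps_comp F (fps_comp G H) =1 fps_comp (fps_comp F G) H.
Proof.
move=> G0 H0; apply: fps_truncP => N.
have GH0 : fps_comp G H 0%N = 0 by rewrite fps_comp_const.
apply: eq_upto_trans (@trunc_comp N F _ GH0) _.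
apply: (@eq_upto_trans _ _ (trunc N F \Po (trunc N G \Po trunc N H))).
  apply: eq_upto_comp => //; first exact: trunc_const.
    by rewrite -horner_coef0 horner_comp (horner_coef0 (trunc N H)) ?trunc_const //
      horner_coef0 trunc_const.
  exact: trunc_comp.
rewrite comp_polyA; apply/eq_upto_sym/(eq_upto_trans (@trunc_comp N _ _ H0)).
by apply: eq_upto_comp => //; rewrite ?trunc_const //; apply: trunc_comp.
Qed.

Lemma fps_mulC F G : fps_mul F G =1 fps_mul G F.
Proof.
apply: fps_truncP => N; apply: eq_upto_trans (trunc_mul _ _) _.
by rewrite mulrC; apply/eq_upto_sym/trunc_mul.
Qed.

Lemma fps_mulA F G H : fps_mul F (fps_mul G H) =1 fps_mul (fps_mul F G) H.
Proof.
apply: fps_truncP => N; apply: eq_upto_trans (trunc_mul _ _) _.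
apply: (@eq_upto_trans _ _ (trunc N F * (trunc N G * trunc N H))).
  by apply: eq_upto_mul => //; apply: trunc_mul.
rewrite mulrA; apply: eq_upto_sym; apply: eq_upto_trans (trunc_mul _ _) _.
by apply: eq_upto_mul => //; apply: trunc_mul.
Qed.

Lemma eq_fps_mul F F' G G' : F =1 F' -> G =1 G' -> fps_mul F G =1 fps_mul F' G'.
Proof. by move=> eF eG n; apply: eq_bigr => i _; rewrite eF eG. Qed.

Lemma eq_fps_exp F F' k : F =1 F' -> fps_exp F k =1 fps_exp F' k.
Proof. by move=> eF; elim: k => //= k IHk; apply: eq_fps_mul. Qed.

Lemma eq_fps_comp F F' G G' : F =1 F' -> G =1 G' -> fps_comp F G =1 fps_comp F' G'.
Proof.
by move=> eF eG n; apply: eq_bigr => k _; rewrite eF (eq_fps_exp _ eG).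
Qed.

Lemma fps_exp_small F k n : F 0%N = 0 -> (n < k)%N -> fps_exp F k n = 0.
Proof.
move=> F0 ltnk; have ltn := ltnSn n.
by rewrite -(coef_trunc _ ltn) trunc_exp // coef_exp_small ?trunc_const.
Qed.

Lemma fps_comp_divX F G : F 0%N = 0 -> G 0%N = 0 ->
  fps_mul (fps_comp (fps_divX F) G) G =1 fps_comp F G.
Proof.
move=> F0 G0; apply: fps_truncP => N; apply: eq_upto_trans (trunc_mul _ _) _.
apply: (@eq_upto_trans _ _ ((trunc N (fps_divX F) * 'X) \Po trunc N G)).
  by rewrite comp_polyM comp_polyX; apply: eq_upto_mul => //; apply: trunc_comp.
apply: eq_upto_trans _ (eq_upto_sym (@trunc_comp N _ _ G0)).
apply: eq_upto_comp; rewrite ?trunc_const // => -[|i] lti; rewrite coefMX.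
  by rewrite trunc_const.
by rewrite !coef_trunc // ltnW.
Qed.

Lemma fps_mul1 F : fps_mul (fps1 C) F =1 F.
Proof.
move=> n; rewrite /fps_mul big_ord_recl big1 ?addr0 => [|i _].
  by rewrite /fps1 eqxx mul1r subn0.
by rewrite /fps1 mul0r.
Qed.

Lemma fps_compX F : F 0%N = 0 -> fps_comp (fpsX C) F =1 F.
Proof.
move=> F0 [|n]; first by rewrite fps_comp_const // F0.
rewrite /fps_comp (bigD1 (Ordinal (isT : (1 < n.+2)%N))) //= big1 ?addr0 => [|k nek].
  by rewrite /fpsX eqxx mul1r /= fps_mulC fps_mul1.
by rewrite /fpsX (_ : (k == 1 :> nat) = false) ?mul0r //; apply: negPf.
Qed.

Lemma fps_mulXS F n : fps_mul (fpsX C) F n.+1 = F n.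
Proof.
rewrite /fps_mul (bigD1 (Ordinal (isT : (1 < n.+2)%N))) //= big1 ?addr0 => [|k nek].
  by rewrite /fpsX eqxx mul1r subSS subn0.
by rewrite /fpsX (_ : (k == 1 :> nat) = false) ?mul0r //; apply: negPf.
Qed.

Lemma fps_mulX0 F : fps_mul (fpsX C) F 0%N = 0.
Proof. by rewrite /fps_mul big_ord1 /fpsX mul0r. Qed.

Lemma fps_mulDl F G H :
  fps_mul (fps_add F G) H =1 fps_add (fps_mul F H) (fps_mul G H).
Proof.
by move=> n; rewrite /fps_add /fps_mul -big_split; apply: eq_bigr => i _; rewrite mulrDl.
Qed.

Lemma fps_mulDr F G H :
  fps_mul F (fps_add G H) =1 fps_add (fps_mul F G) (fps_mul F H).
Proof.
by move=> n; rewrite /fps_add /fps_mul -big_split; apply: eq_bigr => i _; rewrite mulrDr.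
Qed.

Lemma fps_exp_add F h k : fps_mul (fps_exp F h) (fps_exp F k) =1 fps_exp F (h + k).
Proof.
elim: h => [|h IHh] n; first exact: fps_mul1.
by rewrite /= -fps_mulA; apply: eq_fps_mul.
Qed.

Lemma fps_mulIr F G H : H 0%N = 1 -> fps_mul F H =1 fps_mul G H -> F =1 G.
Proof.
move=> H0 eFG n; elim/ltn_ind: n => n IHn.
have := eFG n; rewrite /fps_mul !big_ord_recr /= !subnn H0 !mulr1.
rewrite (eq_bigr (fun i : 'I_n => G i * H (n - i)%N)) => [/addrI//|i _].
by rewrite IHn.
Qed.

End Truncation.

(** * Functional equations of the transforms *)

Section Transform.
Variables (C : fieldType) (A : algType C) (phi psi : {scalar A}) (X : A).
Let m := moment_series psi X.
Let M := moment_series phi X.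
Let w := fps_mul (fpsX C) (fps_add (fps1 C) m).

Let w0 : w 0%N = 0. Proof. exact: fps_mulX0. Qed.

(* If [R o w = m], then [R^-1 o m = w]. *)
Lemma fps_comp_transform (RX RXinv F : fps C) :
  is_R_transform psi X RX -> is_fps_compinv RX RXinv -> F 0%N = 0 ->
  fps_mul (fps_comp (fps_comp (fps_divX F) RXinv) m) w =1 fps_comp F w.
Proof.
move=> [R0 Rw] [I0 _ IR] F0.
have m0 : m 0%N = 0 by [].
have Im : fps_comp RXinv m =1 w.
  move=> n; rewrite -(eq_fps_comp (frefl _) Rw) fps_compA // (eq_fps_comp IR (frefl w)).
  exact: fps_compX.
move=> n; rewrite -(fps_comp_divX F0 w0); apply: eq_fps_mul => // {}n.
by rewrite -fps_compA // (eq_fps_comp (frefl _) Im).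
Qed.

(** By [fps_comp_transform] for [RX], the product of [T(m)] and [w = z (1 + m)] is [RX(w) = m]; the
    factor [z] is the shift of the index. *)
Lemma T_transform_eq (T : fps C) : is_T_transform psi X T ->
  forall n, m n.+1 = fps_mul (fps_comp T m) (fps_add (fps1 C) m) n.
Proof.
case=> RX [RXinv [RP invP defT]] n; case: (RP) => R0 Rw.
have -> : m n.+1 = fps_comp RX w n.+1 by rewrite Rw.
rewrite -(fps_comp_transform RP invP R0) -[RHS]fps_mulXS.
have -> : fps_mul (fpsX C) (fps_mul (fps_comp T m) (fps_add (fps1 C) m)) n.+1 =
          fps_mul (fps_comp T m) w n.+1.
  by rewrite /w !fps_mulA; apply: eq_fps_mul => //; apply: fps_mulC.
apply: eq_fps_mul => // {}n; apply: eq_fps_comp => // {}n; exact: esym.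
Qed.

(** Here [cT(m) w (1 + M) = cRX(w) (1 + M) = M (1 + m)] with [w = z (1 + m)], and [1 + m] cancels
    because its constant coefficient is 1. *)
Lemma cT_transform_eq (cT : fps C) : is_cT_transform phi psi X cT ->
  forall n, M n.+1 = fps_mul (fps_comp cT m) (fps_add (fps1 C) M) n.
Proof.
case=> RX [cRX [RXinv [RP [cR0 cRw] invP defT]]] n.
rewrite -[RHS]fps_mulXS; symmetry; move: n.+1; apply: (@fps_mulIr _ _ _ (fps_add (fps1 C) m)).
  by rewrite /fps_add /fps1 /m /= addr0.
move=> {}n; rewrite -[RHS]cRw -/M -/m -/w.
have cTm : fps_mul (fps_comp cT m) w =1 fps_comp cRX w.
  move=> k; rewrite -(fps_comp_transform RP invP cR0).
  by apply: eq_fps_mul => // {}k; apply: eq_fps_comp.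
rewrite -(eq_fps_mul cTm (frefl _)).
have swap (a b c d : fps C) :
    fps_mul (fps_mul a (fps_mul b c)) d =1 fps_mul (fps_mul b (fps_mul a c)) d.
  move=> k; apply: eq_fps_mul => // {}k.
  by rewrite !fps_mulA; apply: eq_fps_mul => //; apply: fps_mulC.
rewrite /w -(swap (fpsX C)) -!fps_mulA; apply: eq_fps_mul => // {}n.
by rewrite -!fps_mulA; apply: eq_fps_mul => //; apply: fps_mulC.
Qed.

End Transform.

(** * The transposed recurrence *)

Section Duality.
Variables (C : fieldType) (t ct m M : fps C).
Hypotheses (m0 : m 0%N = 0) (M0 : M 0%N = 0).
Hypothesis m_eq : forall n,
  m n.+1 = fps_mul (fps_comp t m) (fps_add (fps1 C) m) n.
Hypothesis M_eq : forall n,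
  M n.+1 = fps_mul (fps_comp ct m) (fps_add (fps1 C) M) n.

Let K h : fps C := fps_mul (fps_exp m h) (fps_add (fps1 C) M).

(** Powers [m ^ k] with [k > n] do not reach degree [n], so any bound [N > n] serves; one common
    bound later allows the sums to be exchanged. *)
Lemma fps_mul_comp (F G : fps C) N n : (n < N)%N ->
  fps_mul (fps_comp F m) G n = \sum_(k < N) F k * fps_mul (fps_exp m k) G n.
Proof.
move=> ltnN; rewrite /fps_mul.
under [RHS]eq_bigr => k _ do rewrite mulr_sumr.
rewrite exchange_big /=; apply: eq_bigr => i _.
rewrite /fps_comp mulr_suml.
have lei : (i.+1 <= N)%N by have := ltn_ord i; lia.
rewrite (big_ord_widen N (fun k => F k * fps_exp m k i * G (n - i)%N)) //.
rewrite big_mkcond; apply: eq_bigr => k _; rewrite -mulrA.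
by case: ltnP => // ltik; rewrite fps_exp_small // mul0r mulr0.
Qed.

Lemma K_small h n : (n < h)%N -> K h n = 0.
Proof.
move=> ltnh; rewrite /K /fps_mul big1 // => i _.
by rewrite fps_exp_small ?mul0r //; have := ltn_ord i; lia.
Qed.

Lemma K_const h : K h 0%N = (h == 0%N)%:R.
Proof.
case: h => [|h]; last by rewrite K_small.
by rewrite /K /fps_mul big_ord1 /fps_add M0 /fps1 /= addr0 mulr1.
Qed.

Lemma fps_mul_K h k n : fps_mul (fps_exp m h) (K k) n = K (h + k) n.
Proof. by rewrite /K fps_mulA; apply: eq_fps_mul => //; apply: fps_exp_add. Qed.

Lemma K0 n : K 0 n = fps_add (fps1 C) M n.
Proof. exact: fps_mul1. Qed.

Lemma K0S N n : (n < N)%N -> K 0 n.+1 = \sum_(d < N) ct d * K d n.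
Proof. by move=> ltn; rewrite K0 /fps_add /fps1 add0r M_eq (fps_mul_comp _ _ ltn). Qed.

Lemma fps_mul_m (F : fps C) n : fps_mul m F n.+1 =
  fps_mul (fps_mul (fps_comp t m) (fps_add (fps1 C) m)) F n.
Proof.
rewrite /fps_mul big_ord_recl m0 mul0r add0r; apply: eq_bigr => i _ /=.
by rewrite m_eq subSS.
Qed.

Lemma mul_m_K h n : fps_mul m (K h) n = K h.+1 n.
Proof. by rewrite /K fps_mulA. Qed.

(** Substitute [m = z t(m) (1 + m)] for one factor [m] of [K h.+1], and use
    [(1 + m) K h = K h + K h.+1]. With [K0S], this is the transpose of [pending_sumS]. *)
Lemma KS N h n : (n < N)%N ->
  K h.+1 n.+1 = \sum_(d < N) t d * (K (h + d) n + K (h + d).+1 n).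
Proof.
move=> ltn; rewrite -mul_m_K fps_mul_m -fps_mulA (fps_mul_comp _ _ ltn).
apply: eq_bigr => d _; congr (_ * _).
have -> : fps_mul (fps_exp m d) (fps_mul (fps_add (fps1 C) m) (K h)) n =
          fps_mul (fps_exp m d) (fps_add (K h) (K h.+1)) n.
  apply: eq_fps_mul => // k.
  by rewrite fps_mulDl /fps_add fps_mul1 mul_m_K.
by rewrite fps_mulDr /fps_add !fps_mul_K addnS [(d + h)%N]addnC.
Qed.

Lemma sum_triangle (N : nat) (F : nat -> nat -> C) :
  \sum_(h < N) \sum_(d < h.+1) F d (h - d)%N =
  \sum_(h < N) \sum_(d < N | (d + h < N)%N) F d h.
Proof.
transitivity (\sum_(h < N) \sum_(d < N | (d <= h)%N) F d (h - d)%N).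
  apply: eq_bigr => h _.
  rewrite (big_ord_widen N (fun d => F d (h - d)%N)) //.
rewrite (exchange_big_dep xpredT) //= [RHS](exchange_big_dep xpredT) //=.
apply: eq_bigr => d _.
rewrite -(big_mkord (fun h => (d <= h)%N) (fun h => F d (h - d)%N)).
rewrite -(big_mkord (fun h => (d + h < N)%N) (fun h => F d h)).
rewrite (big_cat_nat (n := d)) //=; last exact/ltnW.
rewrite big_nat_cond big_pred0 ?add0r => [|h]; last by lia.
rewrite -{1}[d : nat]add0n big_addn.
rewrite [RHS](big_cat_nat (n := (N - d)%N)) //=; last exact: leq_subr.
rewrite [X in _ = _ + X]big_nat_cond [X in _ = _ + X]big_pred0 ?addr0 => [|h]; last by lia.
rewrite big_nat_cond [RHS]big_nat_cond; apply: eq_big => [h|h _]; first by lia.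
by rewrite addnK.
Qed.

Lemma duality_step N a b : (b.+1 < N)%N ->
  \sum_(h < N) pending_sum t ct a.+1 h * K h b =
  \sum_(h < N) pending_sum t ct a h * K h b.+1.
Proof.
move=> ltb; set S := pending_sum t ct a.
transitivity (\sum_(h < N) \sum_(d < h.+1)
    ((if (h - d)%N == 0%N then ct d else t d) * S (h - d)%N * K (d + (h - d))%N b
     + t d * S (h - d).+1 * K (d + (h - d))%N b)).
  apply: eq_bigr => h _; rewrite pending_sumS mulr_suml; apply: eq_bigr => d _.
  by rewrite mulrDl subnKC // -ltnS.
rewrite (@sum_triangle N (fun d e => (if e == 0%N then ct d else t d) * S e * K (d + e)%N b
                     + t d * S e.+1 * K (d + e)%N b)).
(* The triangle extends to a square: the added terms have [d + h >= N > b] and vanish by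
   [K_small]. *)
transitivity (\sum_(h < N) \sum_(d < N)
   ((if (h : nat) == 0%N then ct d else t d) * S h * K (d + h)%N b
                     + t d * S h.+1 * K (d + h)%N b)).
  apply: eq_bigr => h _; rewrite big_mkcond; apply: eq_bigr => d _.
  by case: ltnP => // le; rewrite K_small ?mulr0 ?addr0 //; lia.
under eq_bigr do rewrite big_split.
rewrite big_split /=.
case: N ltb => // N ltb.
(* The first sum releases its term [h = 0], the only one with [ct], and the second its last term,
   which vanishes because [b < N]. What is left of both runs over the factors [S h.+1]. *)
rewrite big_ord_recl [X in _ + X]big_ord_recr /= [RHS]big_ord_recl /=.
rewrite [X in _ + (_ + X)]big1 ?addr0; last first.
  by move=> d _; rewrite K_small ?mulr0 //; lia.
rewrite -addrA; congr (_ + _).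
  rewrite (@K0S N.+1) //; last exact: ltnW.
  by rewrite mulr_sumr; apply: eq_bigr => d _; rewrite addn0 -mulrA mulrCA.
rewrite -big_split /=; apply: eq_bigr => h _.
rewrite (@KS N.+1) //; last exact: ltnW.
rewrite mulr_sumr -big_split; apply: eq_bigr => d _ /=.
rewrite /bump add1n [(d + h.+1)%N]addnC addSn [(d + h)%N]addnC.
by rewrite mulrDr mulrDr addrC; congr (_ + _); rewrite mulrCA mulrA.
Qed.

Lemma pending_sum_eq n : pending_sum t ct n 0 = fps_add (fps1 C) M n.
Proof.
(* At [a = 0] only [h = 0] contributes, since without elements nothing can be pending; below, at
   [a = n], again only [h = 0] does, by [K_const]. *)
have D a : (a <= n)%N -> \sum_(h < n.+2) pending_sum t ct a h * K h (n - a)%N = K 0 n.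
  elim: a => [_|a IHa lta].
    rewrite subn0 big_ord_recl big1 ?addr0 => [|h _]; rewrite pending_sum0 ?mul0r //.
    by rewrite mul1r.
  rewrite duality_step; last by lia.
  by rewrite subnSK // IHa // ltnW.
rewrite -K0 -(D n (leqnn n)) subnn big_ord_recl big1 ?addr0 => [|h _].
  by rewrite K_const mulr1.
by rewrite K_const mulr0.
Qed.

End Duality.

Theorem theorem7p3 (R : realType) (A : algType R[i]) (phi psi : {scalar A})
    (hphi : phi 1 = 1) (hpsi : psi 1 = 1)
    (X : A) (hX : psi X != 0)
    (t ct : fps R[i])
    (ht : is_T_transform psi X t) (hct : is_cT_transform phi psi X ct)
    (n : nat) (hn : (1 <= n)%N) :
  psi (X ^+ n) =
    \sum_(g in NCL n) t 0%N ^+ (n - #|g|) * \prod_(B in g) t #|B|.-1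
  /\
  phi (X ^+ n) =
    \sum_(g in NCL n) t 0%N ^+ (n - #|g|) *
      (\prod_(B in ext g) ct #|B|.-1) *
      (\prod_(B in int_blocks g) t #|B|.-1).
Proof.
case: n hn => // n _.
have Teq := T_transform_eq ht; have cTeq := cT_transform_eq hct.
split.
  (* Formula (i) is the case [ct = t], [M = m], where exterior and interior blocks have the same
     weights and the two products merge. *)
  have := @pending_sum_eq _ t t _ _ (erefl 0) (erefl 0) Teq Teq n.+1.
  rewrite -sum_partition_weight /fps_add /fps1 add0r.
  rewrite -[psi (X ^+ _)]/(moment_series psi X n.+1) => <-.
  apply: eq_bigr => g _; rewrite /partition_weight -mulrA; congr (_ * _).
  rewrite [RHS](bigID (mem (ext g))) /=; congr (_ * _); apply: eq_bigl => B.
    by rewrite /ext inE andbA andbb.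
  by rewrite /int_blocks inE andbC.
have := @pending_sum_eq _ t ct _ _ (erefl 0) (erefl 0) Teq cTeq n.+1.
rewrite -sum_partition_weight /fps_add /fps1 add0r.
by rewrite -[phi (X ^+ _)]/(moment_series phi X n.+1) => <-.
Qed.
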